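(* Let $\mathbf{c}=(c_1,\dots,c_n)\in\mathbb{Z}_{>0}^n$ and $0<k<c_1+\cdots+c_n$. For each $0\le m\le n-1$, the coefficient of $t^m$ in the Ehrhart polynomial of $\mathscr{R}_{k,\mathbf{c}}$ is \[ [t^m]\operatorname{ehr}(\mathscr{R}_{k,\mathbf{c}},t)=\frac{1}{(n-1)!}\sum_{\ell=0}^{k-1} W(\ell,n,m+1,\mathbf{c})\,A(m,k-\ell-1). \]
   Context: $\mathscr{R}_{k,\mathbf{c}}=\{x\in\mathbb{R}^n : 0\le x_i\le c_i \text{ for all } i,\ \sum_i x_i=k\}$, and $\operatorname{ehr}(\mathscr{P},t)$ is the polynomial with $\operatorname{ehr}(\mathscr{P},t)=\#(t\mathscr{P}\cap\mathbb{Z}^n)$ for all positive integers $t$. For $\sigma\in\mathfrak{S}_n$ let $C(\sigma)$ be its set of cycles (fixed points count as cycles of length 1; a cycle is regarded as the set of its elements when summing). A weighted permutation is a pair $(\sigma,w)$ with $\sigma\in\mathfrak{S}_n$ and $w:C(\sigma)\to\mathbb{Z}_{\ge 0}$; its total weight is $w(\sigma)=\sum_{\mathfrak{c}\in C(\sigma)}w(\mathfrak{c})$. It is $\mathbf{c}$-compatible if $w(\mathfrak{c})<\sum_{i\in\mathfrak{c}}c_i$ for every $\mathfrak{c}\in C(\sigma)$. $W(\ell,n,m,\mathbf{c})$ denotes the number of $\mathbf{c}$-compatible weighted permutations $(\sigma,w)$ with $\sigma\in\mathfrak{S}_n$ having exactly $m$ cycles and total weight $\ell$. $A(m,j)$ is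 the Eulerian number: the number of permutations of $[m]$ with exactly $j$ descents (a descent of $\tau$ is an $i\in[m-1]$ with $\tau(i)>\tau(i+1)$); in particular $A(0,0)=1$ and $A(m,j)=0$ when no such permutations exist. *)

(* Defs.v *)
From HB Require Import structures.
From mathcomp Require Import all_boot all_order all_algebra all_fingroup.
From mathcomp Require Import finmap.
From mathcomp Require Import all_classical all_reals.

Set Implicit Arguments.
Unset Strict Implicit.
Unset Printing Implicit Defensive.

Import Order.TTheory GRing.Theory Num.Theory.

Definition descents (m : nat) (s : 'S_m) : {set 'I_m} :=
  [set i : 'I_m | [exists j : 'I_m, (j == i.+1 :> nat) && (s j < s i)]]%SET.

Definition eulerian (m j : nat) : nat :=
  #|[set s : 'S_m | #|descents s| == j]%SET|.

(* The cycles of [s] are the blocks of [porbits s], as sets of elements;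
   fixed points give singleton blocks. *)
Definition cycle_of (n : nat) (s : 'S_n) := {C : {set 'I_n} | C \in porbits s}.

Definition wperm (n : nat) := {s : 'S_n & {ffun cycle_of s -> nat}}.

Definition total_weight (n : nat) (sw : wperm n) : nat :=
  \sum_(C : cycle_of (tag sw)) tagged sw C.

Definition compatible (n : nat) (c : 'I_n -> nat) (sw : wperm n) : Prop :=
  forall C : cycle_of (tag sw), tagged sw C < \sum_(i in val C) c i.

Local Open Scope classical_set_scope.

Definition compatible_wperms (l n m : nat) (c : 'I_n -> nat) : set (wperm n) :=
  [set sw | [/\ compatible c sw, #|porbits (tag sw)| = m
             & total_weight sw = l]].

(* [fset_set] is only meaningful on finite sets. *)
Lemma finite_compatible_wperms (l n m : nat) (c : 'I_n -> nat) :
  finite_set (compatible_wperms l m c).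
Proof.
pose B := \sum_i c i.
pose T := {s : 'S_n & {ffun cycle_of s -> 'I_B}}.
pose g (x : T) : wperm n :=
  Tagged (fun s : 'S_n => {ffun cycle_of s -> nat})
         [ffun C => nat_of_ord (tagged x C)].
apply: (@sub_finite_set _ _ (g @` [set: T])); last first.
  exact/finite_image/finite_finset.
case=> s w [/= cw _ _].
have ltB C : w C < B.
  apply: leq_trans (cw C) _.
  by rewrite /B [leqRHS](bigID (mem (val C))) /= leq_addr.
exists (Tagged (fun s : 'S_n => {ffun cycle_of s -> 'I_B})
         [ffun C => Ordinal (ltB C)]) => //.
rewrite /g /=; congr (existT _ _ _).
by apply/ffunP => C; rewrite !ffunE.
Qed.

Definition W (l n m : nat) (c : 'I_n -> nat) : nat :=
  #|` fset_set (compatible_wperms l m c)|%fset.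

Local Open Scope ring_scope.

Definition polytope_R (R : realType) (n k : nat) (c : 'I_n -> nat) :
    set 'rV[R]_n :=
  [set x | (forall i, 0 <= x ord0 i <= (c i)%:R) /\
           \sum_i x ord0 i = k%:R].
Arguments polytope_R R {n} k c _.

Definition dilate (R : realType) (n t : nat) (P : set 'rV[R]_n) :
    set 'rV[R]_n :=
  [set t%:R *: x | x in P].

Definition lattice_points (R : realType) (n : nat) (P : set 'rV[R]_n) :
    set 'rV[int]_n :=
  [set z | P (map_mx intr z)].

Definition is_ehrhart_poly (R : realType) (n : nat) (P : set 'rV[R]_n)
    (p : {poly rat}) : Prop :=
  forall t : nat, (0 < t)%N ->
    finite_set (lattice_points (dilate t P)) /\
    p.[t%:R] = #|` fset_set (lattice_points (dilate t P))|%fset%:R.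

(* Main.v *)
Require Import Defs.
From HB Require Import structures.
From mathcomp Require Import all_boot all_order all_algebra all_fingroup.
From mathcomp Require Import zify ring.

Set Implicit Arguments.
Unset Strict Implicit.
Unset Printing Implicit Defensive.

Import Order.TTheory GRing.Theory Num.Theory.
Local Open Scope ring_scope.

(** Write [c(S)] for the sum of the [c i] over [i] in [S].  Expanding
    [prod_i (1 + x + ... + x^(t c_i))] by inclusion-exclusion gives
    [(n-1)! ehr(t) = sum_(c(S) < k) (-1)^|S| prod_(0 < j < n) (t (k - c(S)) + j - |S|)].
    On the other side, let [N_m(z)] be the generating function of [W(l, n, m+1, c)].
    Since [(1 - z)^(m+1) N_m(z)] sums [prod_C (1 - z^c(C))] over the permutations with
    [m+1] cycles [C], it is the coefficient of [y^(m+1)] in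
    [sum_S (-1)^|S| z^c(S) y prod_(0 < j < n) (y + j - |S|)]:
    both sides obey the recursion that inserts a new element into a cycle.
    Worpitzky's identity [sum_(j > 0) j^m z^j = z A_m(z) / (1 - z)^(m+1)] then matches
    the two formulas.  Power series are replaced by polynomials modulo [z^K]. *)

(** * Cycles of a permutation and insertion of an element *)

Lemma porbit_subset (T : finType) (s : {perm T}) (x : T) (U : {set T}) :
  x \in U -> {in U, forall y, s y \in U} -> porbit s x \subset U.
Proof.
move=> xU sU; apply/subsetP => _ /porbitP[i ->].
elim: i => [|i IHi]; first by rewrite expg0 perm1.
by rewrite expgSr permM sU.
Qed.

Lemma porbit_closed (T : finType) (s : {perm T}) (x y : T) :
  y \in porbit s x -> s y \in porbit s x.
Proof. by case/porbitP=> i ->; rewrite -permM -expgSr mem_porbit. Qed.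

Section CycleInsertion.

Variables (T : finType) (A : {set T}) (a j : T) (s : {perm T}).
Hypotheses (aNA : a \notin A) (jA : j \in A) (s_on : perm_on A s).

Let sa : s a = a := out_perm s_on aNA.

Let grow (C : {set T}) := if j \in C then (a |: C) else C.

(** Products of permutations act from left to right, so [tperm a j * s] sends [j] to [a] and [a] to
    [s j]: the fixed point [a] is inserted just after [j], and among the cycles in [A] only the one
    through [j] changes. *)
Lemma porbit_tperm_mul (x : T) : x \in A ->
  porbit (tperm a j * s)%g x = grow (porbit s x).
Proof.
move=> xA; set t := (tperm a j * s)%g.
have tj : t j = a by rewrite permM tpermR.
have ta : t a = s j by rewrite permM tpermL.
have tD y : y != a -> y != j -> t y = s y.
  by move=> ya yj; rewrite permM tpermD // eq_sym.
have sub_st : porbit s x \subset porbit t x.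
  suff : porbit s x \subset porbit t x :&: A.
    by rewrite subsetI => /andP[].
  apply: porbit_subset => [|y]; first by rewrite inE porbit_id.
  rewrite !inE (perm_closed _ s_on) => /andP[ytx yA]; rewrite yA andbT.
  have ya : y != a by apply: contraNneq aNA => <-.
  have [eyj|yj] := eqVneq y j; last by rewrite -tD // porbit_closed.
  by rewrite eyj -ta porbit_closed // -tj porbit_closed // -eyj.
apply/eqP; rewrite eqEsubset; apply/andP; split; last first.
  rewrite /grow; case: ifP => // jx; rewrite subUset sub_st sub1set andbT.
  by rewrite -tj porbit_closed // (subsetP sub_st).
apply: porbit_subset => [|y].
  by rewrite /grow; case: ifP; rewrite ?inE porbit_id ?orbT.
have sa' y0 : y0 \in porbit s x -> y0 != a.
  apply: contraTneq => ->; apply/negP => aP.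
  have /subsetP/(_ _ aP) : porbit s x \subset A.
    by apply: porbit_subset => // z zA; rewrite perm_closed.
  by rewrite (negbTE aNA).
rewrite /grow; case: ifP => jx.
  rewrite !inE => /predU1P[->|yx]; first by rewrite ta porbit_closed ?orbT.
  have [->|yj] := eqVneq y j; first by rewrite tj eqxx.
  by rewrite tD ?sa' // porbit_closed ?orbT.
move=> yx; rewrite tD ?sa' ?porbit_closed //.
by apply: contraFneq jx => <-.
Qed.

(** The inclusions discard the singleton cycles of outside points. In the product, the cycle through
    [a] is also the cycle through [j], so every remaining cycle meets [A]. *)
Lemma porbits_tperm_mul :
  [set C in porbits (tperm a j * s)%g | C \subset a |: A]
  = [set grow C | C in [set C in porbits s | C \subset A]].
Proof.
have subA x : x \in A -> porbit s x \subset A.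
  by move=> xA; apply: porbit_subset => // z zA; rewrite perm_closed.
have t_on : perm_on (a |: A) (tperm a j * s)%g.
  apply: perm_onM.
    apply: subset_trans (tperm_on a j) _.
    by rewrite subUset !sub1set !inE eqxx jA orbT.
  by apply: subset_trans s_on _; rewrite subsetUr.
apply/setP => C; rewrite inE; apply/andP/imsetP => [[]|[D]].
  case/imsetP=> x _ ->{C} sub.
  have /(_ x (porbit_id _ _)) := subsetP sub; rewrite !inE.
  case/predU1P=> [xa|xA].
    exists (porbit s j); first by rewrite inE subA // imset_f.
    rewrite -porbit_tperm_mul //; apply/eqP.
    by rewrite eq_porbit_mem -porbitV (_ : x = (tperm a j * s)%g j)
       ?porbitV ?porbit_closed ?porbit_id // permM tpermR sa.
  by exists (porbit s x); rewrite ?porbit_tperm_mul // inE subA // imset_f.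
rewrite inE => /andP[/imsetP[x _ ->{D}]].
move=> /subsetP/(_ x (porbit_id _ _)) xA ->{C}.
rewrite -porbit_tperm_mul // imset_f //; split=> //.
apply: porbit_subset => [|z]; first by rewrite inE xA orbT.
by rewrite (perm_closed _ t_on).
Qed.

Lemma grow_inj : {in [set C in porbits s | C \subset A] &, injective grow}.
Proof.
have growK (C : {set T}) : C \subset A -> (grow C :\ a) = C.
  move=> CA; have aC : a \notin C.
    by apply: contra aNA => /(subsetP CA).
  rewrite /grow; case: ifP => _; first by rewrite setU1K.
  by apply/setDidPl; rewrite disjoint_sym disjoints1.
move=> C D; rewrite !inE => /andP[_ CA] /andP[_ DA] /(congr1 (fun E => E :\ a)).
by rewrite !growK.
Qed.

Lemma prod_porbits_tperm_mul (R : comPzRingType) (F : R -> R) (u : T -> R) :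
  \prod_(C in porbits (tperm a j * s)%g | C \subset a |: A)
     F (\prod_(i in C) u i)
  = \prod_(C in porbits s | C \subset A)
     F (\prod_(i in C) (if i == j then u j * u a else u i)).
Proof.
transitivity (\prod_(C in [set C in porbits (tperm a j * s)%g | C \subset a |: A])
     F (\prod_(i in C) u i)); first by apply: eq_bigl => C; rewrite inE.
rewrite porbits_tperm_mul big_imset /=; last exact: grow_inj.
apply: eq_big => C; first by rewrite inE.
rewrite inE => /andP[_ /subsetP CA]; congr F; rewrite /grow.
case: ifP => jC; last first.
  by apply: eq_bigr => i iC; case: eqP => // eij; rewrite -eij iC in jC.
rewrite big_setU1 /=; last by apply: contra aNA => /CA.
rewrite (big_setD1 j) //= [RHS](big_setD1 j) //= eqxx mulrA [u a * _]mulrC.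
by congr (_ * _); apply: eq_bigr => i; rewrite !inE => /andP[/negbTE ->].
Qed.

End CycleInsertion.

(** * Weighted sums over the permutations of a set *)

(** Permutations of [A] are encoded as permutations of [T] supported in [A], so that an induction
    can vary [A]; [C \subset A] leaves out the fixed points outside [A]. *)
Definition cycle_sum (R : comPzRingType) (T : finType) (F : R -> R)
    (A : {set T}) (u : T -> R) : R :=
  \sum_(s : {perm T} | perm_on A s)
     \prod_(C in porbits s | C \subset A) F (\prod_(i in C) u i).

Lemma cycle_sum0 (R : comPzRingType) (T : finType) (F : R -> R) (u : T -> R) :
  cycle_sum F set0 u = 1.
Proof.
rewrite /cycle_sum (big_pred1 1%g) => [|s].
  rewrite big1 // => C; rewrite subset0 => /andP[/imsetP[x _ ->] /eqP/setP/(_ x)].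
  by rewrite porbit_id inE.
apply/idP/eqP => [|->]; last exact: perm_on1.
by move/perm_on_id; apply; rewrite cards0.
Qed.

(* Either [a] is a fixed point, or [a] is removed from its cycle and its weight is
   absorbed by its predecessor [j]. *)
Lemma cycle_sum_setU1 (R : comPzRingType) (T : finType) (F : R -> R) (A : {set T})
    (a : T) (u : T -> R) : a \notin A ->
  cycle_sum F (a |: A) u = F (u a) * cycle_sum F A u
    + \sum_(j in A) cycle_sum F A (fun i => if i == j then u j * u a else u i).
Proof.
move=> aNA; rewrite {1}/cycle_sum.
rewrite (partition_big (fun s : {perm T} => s^-1 a)%g (mem (a |: A))) /=; last first.
  by move=> s /perm_onV s_on; rewrite (perm_closed _ s_on) !inE eqxx.
rewrite big_setU1 //=; congr (_ + _).
  rewrite /cycle_sum big_distrr /=; apply: eq_big => s.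
    apply/andP/idP => [[s_on /eqP sa]|s_on]; last first.
      split; first by apply: subset_trans s_on (subsetUr _ _).
      by rewrite -{1}(out_perm s_on aNA) permK.
    apply/subsetP => x /[dup] /(subsetP s_on); rewrite !inE.
    by case/predU1P=> // ->; rewrite -{1}sa permKV eqxx.
  case/andP=> s_on /eqP sa.
  have saa : s a = a by rewrite -{1}sa permKV.
  have porb_a : porbit s a = [set a].
    apply/eqP; rewrite eqEsubset sub1set porbit_id andbT.
    by apply: porbit_subset => [|y]; rewrite inE // => /eqP ->; rewrite saa inE.
  rewrite (bigD1 [set a]) /=; last first.
    by rewrite subsetUl -porb_a imset_f.
  rewrite big_set1; congr (_ * _); apply: eq_bigl => C; rewrite -andbA.
  case CP: (C \in _) => //=; apply/andP/idP => [[/subsetP CA Ca]|CA].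
    apply/subsetP => x /[dup] /CA; rewrite !inE => /predU1P[->|//] aC.
    case/imsetP: CP Ca => y _ eC; rewrite eC in aC *.
    rewrite porbit_sym -eq_porbit_mem eq_sym -porb_a in aC *.
    by rewrite (eqP aC) eqxx.
  split; first by apply: subset_trans CA (subsetUr _ _).
  by apply: contraNneq aNA => eC; rewrite (subsetP CA) // eC inE.
apply: eq_bigr => j jA; rewrite /cycle_sum.
(* Multiplication by the transposition is a bijection from the permutations of [A] to those of
   [a |: A] that send [j] to [a]. *)
rewrite (reindex_inj (mulgI (tperm a j))) /=.
have t_on : perm_on (a |: A) (tperm a j).
  apply: subset_trans (tperm_on a j) _.
  by rewrite subUset !sub1set !inE eqxx jA orbT.
have cond s : perm_on (a |: A) (tperm a j * s)%g
    && ((tperm a j * s)^-1 a == j)%g = perm_on A s.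
  apply/andP/idP => [[s_on /eqP sj]|s_on]; last first.
    split; last first.
      rewrite -(inj_eq (@perm_inj _ (tperm a j * s)%g)) permKV permM tpermR.
      by rewrite (out_perm s_on).
    by apply: perm_onM => //; apply: subset_trans s_on (subsetUr _ _).
  have sa : s a = a.
    by have := permKV (tperm a j * s)%g a; rewrite sj permM tpermR.
  have s_on' : perm_on (a |: A) s.
    by rewrite -[s](mulKg (tperm a j)) tpermV; apply: perm_onM.
  apply/subsetP => x /[dup] /(subsetP s_on'); rewrite !inE.
  by case/predU1P=> // ->; rewrite sa eqxx.
by apply: eq_big => [s|s]; rewrite cond // => s_on; rewrite -prod_porbits_tperm_mul.
Qed.

Lemma sum_subset_setU1 (R : nmodType) (T : finType) (A : {set T}) (a : T)
    (f : {set T} -> R) : a \notin A ->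
  \sum_(S : {set T} | S \subset a |: A) f S
  = \sum_(S : {set T} | S \subset A) (f S + f (a |: S)).
Proof.
move=> aNA; rewrite (bigID (fun S : {set T} => a \in S)) /= addrC big_split /=.
congr (_ + _).
  apply: eq_bigl => S; apply/andP/idP => [[/subsetP SA aS]|SA].
    apply/subsetP => x xS; have := SA x xS; rewrite !inE => /predU1P[ex|//].
    by rewrite -ex xS in aS.
  split; first by apply: subset_trans SA (subsetUr _ _).
  by apply: contra aNA => /(subsetP SA).
rewrite (reindex_onto (fun S => a |: S) (fun S => S :\ a)) /=; last first.
  by move=> S /andP[_ aS]; rewrite setD1K.
apply: eq_bigl => S; rewrite !inE eqxx andbT.
apply/andP/idP => [[SA /eqP eS]|SA].
  have aNS : a \notin S by rewrite -eS !inE eqxx.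
  apply/subsetP => x xS; have /subsetP/(_ x) := SA; rewrite !inE xS orbT.
  by case/(_ isT)/predU1P => // ex; rewrite -ex xS in aNS.
split; first by apply: setUS.
by rewrite setU1K //; apply: contra aNA => /(subsetP SA).
Qed.

(** For an integer y >= s this is n! times the binomial of y - s + n over n; at s = 0 it is the
    rising factorial (y + 1) ... (y + n). *)
Definition shifted_rising (R : pzRingType) (y : R) (n s : nat) : R :=
  \prod_(j < n) (y + j.+1%:R - s%:R).

Lemma shifted_risingS (R : pzRingType) (y : R) (n s : nat) :
  shifted_rising y n.+1 s = shifted_rising y n s * (y + n.+1%:R - s%:R).
Proof. by rewrite /shifted_rising big_ord_recr. Qed.

Lemma shifted_risingSS (R : comPzRingType) (y : R) (n s : nat) :
  shifted_rising y n.+1 s.+1 = (y - s%:R) * shifted_rising y n s.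
Proof.
rewrite /shifted_rising big_ord_recl /=; congr (_ * _).
  by rewrite -[s.+1]add1n natrD; ring.
apply: eq_bigr => i _; rewrite /= /bump leq0n add1n.
by rewrite -[s.+1]addn1 -[i.+2]addn1 !natrD; ring.
Qed.

(** By induction on [A], removing a point [a]. For each [S] avoiding [a], the recursion of
    [cycle_sum_setU1] has to produce the terms of both [S] and [a |: S]. *)
Lemma cycle_sum_subsets (R : comPzRingType) (T : finType) (y : R) (n : nat)
    (A : {set T}) (u : T -> R) : #|A| = n.+1 ->
  cycle_sum (fun v => y * (1 - v)) A u
  = \sum_(S : {set T} | S \subset A)
      (-1) ^+ #|S| * (\prod_(i in S) u i) * (y * shifted_rising y n #|S|).
Proof.
elim: n A u => [|n IHn] A u cardA.
  have /cards1P[a ->] : #|A| == 1%N by rewrite cardA.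
  rewrite -(setU0 [set a]) cycle_sum_setU1 ?inE // cycle_sum0 big_set0.
  rewrite sum_subset_setU1 ?inE // (big_pred1 set0); last first.
    by move=> S; rewrite subset0.
  rewrite setU0 cards0 cards1 big_set0 big_set1 /shifted_rising !big_ord0.
  by rewrite expr0 expr1; ring.
have [a aA] : exists a, a \in A by apply/card_gt0P; rewrite cardA.
rewrite -(setD1K aA); move: (setD11 a A) cardA; rewrite (cardsD1 a) aA add1n.
move: (A :\ a) => B /negbT aNB [cardB].
rewrite cycle_sum_setU1 // sum_subset_setU1 // IHn //.
under [X in _ + X]eq_bigr do rewrite IHn //.
rewrite exchange_big /= big_distrr -big_split /=; apply: eq_bigr => S SB.
have aNS : a \notin S by apply: contra aNB => /(subsetP SB).
rewrite big_setU1 //= cardsU1 aNS add1n -mulr_suml -mulr_sumr.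
(* A predecessor [j] in [S] brings in a factor [u a]; one outside [S] leaves the product over [S]
   unchanged. *)
have -> : \sum_(j in B) \prod_(i in S) (if i == j then u j * u a else u i)
    = (\prod_(i in S) u i) * (#|S|%:R * u a + (n.+1%:R - #|S|%:R)).
  rewrite (bigID (mem S)) /= mulrDr; congr (_ + _).
    rewrite (eq_bigl (mem S)) => [|j]; last first.
      by apply/andP/idP => [[]//|jS]; rewrite (subsetP SB).
    rewrite (eq_bigr (fun=> (\prod_(i in S) u i) * u a)) => [|j jS].
      by rewrite sumr_const -mulr_natl; ring.
    rewrite (big_setD1 j) //= [X in _ = X * _](big_setD1 j) //= eqxx.
    rewrite -mulrA [u a * _]mulrC mulrA; congr (_ * _ * _).
    by apply: eq_bigr => i; rewrite !inE => /andP[/negbTE ->].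
  rewrite (eq_bigl (mem (B :\: S))) => [|j]; last by rewrite !inE andbC.
  rewrite (eq_bigr (fun=> \prod_(i in S) u i)) => [|j]; last first.
    rewrite !inE => /andP[jS _]; apply: eq_bigr => i iS.
    by case: eqP => // eij; rewrite -eij iS in jS.
  rewrite sumr_const cardsD (setIidPr SB) cardB -natrB ?mulr_natr //.
  by rewrite -cardB subset_leq_card.
(* With s = |S|, the total factor is y (1 - u a) + s u a + (n + 1 - s) = (y + n + 1 - s) - u a (y -
   s). The first term extends the product for [S], the second the one for [a |: S]. *)
rewrite shifted_risingS shifted_risingSS exprS.
move: (shifted_rising _ _ _) ((-1) ^+ _) (\prod_(i in S) _) => r e p; ring.
Qed.

(** * Descents under insertion of the maximum, and Worpitzky's identity *)

Section InsertMaximum.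

Variables (m : nat) (s : 'S_m) (p : 'I_m.+1).
Let t := lift_perm p ord_max s.

Let t_lift i : t (lift p i) = s i :> nat.
Proof. by rewrite lift_perm_lift /= /bump leqNgt ltn_ord. Qed.

Let t_p : t p = m :> nat. Proof. by rewrite lift_perm_id. Qed.

(** As a word, [t] is [s] with the maximum [m] inserted at position [p]. The letters at [i] and
    [i.+1] stay adjacent unless [i.+1] is [p], in which case the letter at [i] is followed by the
    maximum, an ascent. *)
Lemma lift_descents (i : 'I_m) :
  (lift p i \in descents t) = (i \in descents s) && (i.+1 != p :> nat).
Proof.
rewrite !inE; apply/existsP/andP => [[j /andP[/eqP ej]]|[/existsP[j]]].
  rewrite t_lift; case: (unliftP p j) ej => [j' ->|->] ej; last first.
    by rewrite t_p ltnNge ltnW.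
  move: ej; rewrite t_lift /= /bump => ej lt_s; split; last by lia.
  by apply/existsP; exists j'; rewrite lt_s andbT; lia.
case/andP=> /eqP ej lt_s ip; exists (lift p j).
by rewrite !t_lift lt_s andbT /= /bump; lia.
Qed.

Lemma insertion_descent : (p \in descents t) = (p < m)%N.
Proof.
rewrite inE; apply/existsP/idP => [[j /andP[/eqP ej _]]|pm].
  by rewrite -ltnS -ej.
exists (lift p (Ordinal pm)); rewrite t_lift t_p ltn_ord andbT /= /bump leqnn.
by rewrite add1n.
Qed.

(** The maximum starts a descent unless it is last, and it destroys the descent into whose gap it
    falls, if any. *)
Lemma card_descents_insert :
  #|descents t| =
    (#|descents s| + ((p < m) && ~~ [exists i in descents s, i.+1 == p :> nat]))%N.
Proof.
have -> : #|descents t| = ((p < m) + #|[set i in descents s | i.+1 != p :> nat]|)%N.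
  rewrite -sum1_card big_mkcond (bigD1_ord p) //= insertion_descent; congr addn.
  rewrite -sum1_card [RHS]big_mkcond /=; apply: eq_bigr => i _.
  by rewrite lift_descents [in RHS]in_set.
case: existsP => [[i /andP[iD ip]]|noi].
  have pm : (p < m)%N.
    move: iD; rewrite inE => /existsP[j /andP[/eqP ej _]].
    by rewrite -(eqP ip) -ej.
  rewrite pm addn0 (cardsD1 i (descents s)) iD; congr addn; apply: eq_card => q.
  rewrite !inE andbC; congr andb.
  by rewrite -(eqP ip) eqSS.
rewrite andbT addnC; congr addn; apply: eq_card => i; rewrite inE andbC.
case: eqP => //= ip; apply/esym/negbTE/negP => iD.
by apply: noi; exists i; rewrite iD ip eqxx.
Qed.

End InsertMaximum.

Lemma lift_perm_max_bij (m : nat) :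
  bijective (fun ps : 'I_m.+1 * 'S_m => lift_perm ps.1 ord_max ps.2).
Proof.
apply: inj_card_bij; last by rewrite card_prod card_ord !card_Sn factS.
case=> p s [q t] /= e.
have epq : p = q.
  by apply: (@perm_inj _ (lift_perm p ord_max s)); rewrite {2}e !lift_perm_id.
rewrite -epq in e *; congr pair; apply/permP => i.
by have /permP/(_ (lift p i)) := e; rewrite !lift_perm_lift => /lift_inj.
Qed.

(** The Eulerian recurrence, tested against an arbitrary [g]: the last position and the d descent
    gaps keep the number of descents, the other m - d positions raise it by one. *)
Lemma sum_insert_descents (m : nat) (s : 'S_m) (g : nat -> nat) :
  (\sum_(p < m.+1) g #|descents (lift_perm p ord_max s)|
   = #|descents s|.+1 * g #|descents s| + (m - #|descents s|) * g #|descents s|.+1)%N.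
Proof.
set d := #|_|.
pose b (p : 'I_m.+1) := (p < m)%N && ~~ [exists i in descents s, i.+1 == p :> nat].
have cardNb : #|[predC b]| = d.+1.
  have -> : #|[predC b]| =
      #|(ord_max : 'I_m.+1) |: [set inord (nat_of_ord i).+1 | i in descents s]|.
    apply: eq_card => p; rewrite !inE /= negb_and negbK -leqNgt; congr orb.
      by rewrite -val_eqE /= eqn_leq leq_ord.
    apply/existsP/imsetP => [[i /andP[iD /eqP ip]]|[i iD ->]]; exists i => //.
      by apply: val_inj; rewrite /= inordK ip.
    by rewrite iD inordK ?eqxx // ltnS.
  rewrite cardsU1 card_in_imset ?add1n => [|i j _ _ /(congr1 val)]; last first.
    by rewrite /= !inordK ?ltnS // => -[/val_inj].
  case: imsetP => // -[i]; rewrite inE => /existsP[j /andP[/eqP ej _]].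
  move/(congr1 val); rewrite /= inordK ?ltnS // -ej => em.
  by have := ltn_ord j; rewrite -em ltnn.
have cardb : #|b| = (m - d)%N.
  have := subset_leq_card (subsetT (descents s)); rewrite cardsT card_ord -/d => dm.
  by apply/eqP; rewrite -(eqn_add2r d.+1) -{1}cardNb cardC card_ord; lia.
rewrite (bigID b) /= addnC; congr addn.
  rewrite (eq_bigr (fun=> g d)) ?sum_nat_const ?cardNb // => p nb.
  by rewrite card_descents_insert -/(b p) (negbTE nb) addn0.
rewrite (eq_bigr (fun=> g d.+1)) ?sum_nat_const ?cardb // => p bp.
by rewrite card_descents_insert -/(b p) bp addn1.
Qed.

Lemma card_descents_le (m : nat) (s : 'S_m) : (#|descents s| <= m.-1)%N.
Proof.
case: m s => [|m] s; first by apply: leq_trans (max_card _) _; rewrite card_ord.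
rewrite -ltnS -[X in (_ <= X)%N](card_ord m.+1) -cardsT proper_card //.
rewrite properT; apply/eqP => /setP/(_ ord_max); rewrite !inE => /existsP[j].
by case/andP=> /eqP ej _; have := ltn_ord j; rewrite ej ltnn.
Qed.

Lemma worpitzky_perm (m j : nat) :
  (\sum_(s : 'S_m) 'C(j + m - #|descents s|, m) = j.+1 ^ m)%N.
Proof.
elim: m => [|m IHm].
  by rewrite (eq_bigr (fun=> 1%N)) ?sum1_card ?card_Sn // => s; rewrite bin0.
rewrite (reindex _ (onW_bij _ (lift_perm_max_bij m))).
rewrite -(pair_bigA _ (fun p s =>
  'C(j + m.+1 - #|descents (lift_perm p ord_max s)|, m.+1))) /=.
rewrite exchange_big /= expnS -IHm big_distrr /=; apply: eq_bigr => s _.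
rewrite (sum_insert_descents s (fun d => 'C(j + m.+1 - d, m.+1))).
have := card_descents_le s; move: #|_| => d led.
have -> : (j + m.+1 - d = (j + m - d).+1)%N by lia.
have -> : (j + m.+1 - d.+1 = j + m - d)%N by lia.
(* With x = j + m - d, Pascal's rule and (m + 1) C(x, m + 1) = (x - m) C(x, m) yield (d + 1) C(x +
   1, m + 1) + (m - d) C(x, m + 1) = (j + 1) C(x, m). If j < d all these binomials vanish; otherwise
   x - m = j - d. *)
rewrite binS; have := mul_bin_left (j + m - d) m.
have [ltjd|ledj] := ltnP j d; first by rewrite !bin_small //; lia.
have -> : (j + m - d - m = j - d)%N by lia.
by move: 'C(_, _) 'C(_, _) => z x e; nia.
Qed.

(** * Power series computations modulo a power of the variable *)

Section TruncatedPoly.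

Variable R : comNzRingType.
Implicit Types (p q : {poly R}) (K : nat).

Definition eqmodXn K p q : Prop := forall i, (i < K)%N -> p`_i = q`_i.

Lemma eqmodXn_refl K p : eqmodXn K p p. Proof. by []. Qed.

Lemma eqmodXn_sym K p q : eqmodXn K p q -> eqmodXn K q p.
Proof. by move=> pq i iK; rewrite pq. Qed.

Lemma eqmodXnM K p p' q q' :
  eqmodXn K p p' -> eqmodXn K q q' -> eqmodXn K (p * q) (p' * q').
Proof.
move=> epp eqq i iK; rewrite !coefM; apply: eq_bigr => j _.
by rewrite epp ?eqq //; have := ltn_ord j; lia.
Qed.

Lemma eqmodXn_prod K (I : Type) (r : seq I) (P : pred I) (F G : I -> {poly R}) :
  (forall i, P i -> eqmodXn K (F i) (G i)) ->
  eqmodXn K (\prod_(i <- r | P i) F i) (\prod_(i <- r | P i) G i).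
Proof.
move=> FG; elim/big_rec2: _ => // i p q Pi; exact/eqmodXnM/FG.
Qed.

Lemma eqmodXnX K p q n : eqmodXn K p q -> eqmodXn K (p ^+ n) (q ^+ n).
Proof. by move=> pq; elim: n => // n IHn; rewrite !exprS; apply: eqmodXnM. Qed.

(** For [n = K] this stands for 1 / (1 - z) modulo z^K. *)
Definition geom (n : nat) : {poly R} := \sum_(i < n) 'X^i.

Lemma geomE n : (1 - 'X) * geom n = 1 - 'X^n.
Proof. by rewrite -[1 - 'X^n]opprB subrX1 -mulNr opprB. Qed.

Lemma coef_geom n i : (geom n)`_i = (i < n)%N%:R.
Proof.
have -> : geom n = \poly_(i < n) 1.
  by rewrite poly_def; apply: eq_bigr => j _; rewrite scale1r.
by rewrite coef_poly; case: ifP.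
Qed.

Lemma sum_bin_diag m i : (\sum_(j < i.+1) 'C(j + m, m) = 'C(i + m.+1, m.+1))%N.
Proof.
elim: i => [|i IHi]; first by rewrite big_ord1 !add0n !binn.
by rewrite big_ord_recr /= IHi addSnnS [in RHS]addSn binS.
Qed.

(** Below degree [K], multiplying by [geom K] takes partial sums of coefficients, so the
    hockey-stick identity gives the induction. *)
Lemma coef_geomX K m i : (i < K)%N -> (geom K ^+ m.+1)`_i = 'C(i + m, m)%:R.
Proof.
elim: m i => [|m IHm] i iK; first by rewrite expr1 coef_geom iK addn0 bin0.
rewrite exprSr coefM -sum_bin_diag natr_sum; apply: eq_bigr => j _.
have := ltn_ord j; rewrite ltnS => ji.
rewrite IHm ?(leq_ltn_trans ji) // coef_geom.
by rewrite (leq_ltn_trans (leq_subr _ _) iK) mulr1.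
Qed.

Lemma oneBXn_eqmod K : eqmodXn K (1 - 'X^K) 1.
Proof. by move=> i iK; rewrite coefB coefXn (ltn_eqF iK) subr0. Qed.

Lemma geom_eqmod K n : eqmodXn K (geom n) ((1 - 'X^n) * geom K).
Proof.
rewrite -geomE mulrAC geomE -[X in eqmodXn _ X]mul1r.
by apply/eqmodXnM/eqmodXn_refl/eqmodXn_sym/oneBXn_eqmod.
Qed.

Lemma prod_oneBXn (I : finType) (a : I -> nat) :
  \prod_i (1 - 'X^(a i)) =
  \sum_(S : {set I}) (-1) ^+ #|S| *: 'X^(\sum_(i in S) a i) :> {poly R}.
Proof.
under eq_bigr do rewrite addrC.
rewrite bigA_distr; apply: eq_bigr => S _.
rewrite -mul_polyC rmorphXn rmorphN1.
rewrite -big_mkcond /= -prodrXr -prodr_const -big_split /=.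
by apply: eq_bigr => i _; rewrite mulN1r.
Qed.

(** Inclusion-exclusion on the upper bounds: [S] collects indices whose bound is violated, and the
    binomial counts the ways to write the remainder as a sum of n + 1 natural numbers. *)
Lemma coef_prod_geom (I : finType) (n : nat) (a : I -> nat) (N : nat) :
  #|I| = n.+1 ->
  (\prod_i geom (a i))`_N =
  \sum_(S : {set I} | (\sum_(i in S) a i <= N)%N)
     (-1) ^+ #|S| * 'C(N - \sum_(i in S) a i + n, n)%:R.
Proof.
move=> cardI.
have /(_ N (ltnSn N)) -> : eqmodXn N.+1 (\prod_i geom (a i))
    ((\prod_i (1 - 'X^(a i))) * geom N.+1 ^+ n.+1).
  rewrite -cardI -prodr_const -big_split; apply: eqmodXn_prod => i _.
  exact: geom_eqmod.
rewrite prod_oneBXn mulr_suml coef_sum [RHS]big_mkcond; apply: eq_bigr => S _.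
rewrite -scalerAl coefZ coefXnM ltnNge.
case: leqP => /= leSN; last by rewrite mulr0.
by rewrite coef_geomX // ltnS leq_subr.
Qed.

End TruncatedPoly.

Arguments geom {R}.

Lemma rmorph_shifted_rising (R S : pzRingType) (f : {rmorphism R -> S}) y n s :
  f (shifted_rising y n s) = shifted_rising (f y) n s.
Proof.
rewrite /shifted_rising rmorph_prod; apply: eq_bigr => j _.
by rewrite rmorphB rmorphD !rmorph_nat.
Qed.

Lemma coef_comp_scaleX (R : comNzRingType) (p : {poly R}) (a : R) (m : nat) :
  (p \Po (a *: 'X))`_m = a ^+ m * p`_m.
Proof.
rewrite comp_polyE coef_sum.
under eq_bigr do rewrite exprZn scalerA coefZ coefXn.
have [mp|pm] := ltnP m (size p); last first.
  rewrite big1 ?[p`_m]nth_default ?mulr0 // => i _.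
  by rewrite [m == i]gtn_eqF ?mulr0 // (leq_trans (ltn_ord i)).
rewrite (bigD1 (Ordinal mp)) //= eqxx mulr1 mulrC big1 ?addr0 // => i.
by rewrite -val_eqE /= eq_sym => /negbTE ->; rewrite mulr0.
Qed.

(** * The generating function of the compatible weighted permutations *)

Section CoefficientIdentity.

Variables (n : nat) (c : 'I_n.+1 -> nat).

(** A cycle may carry any weight below the sum of its [c i], hence the factor [geom]; [W_coef] shows
    that the coefficient of z^l is [W l m c]. *)
Definition cycle_poly (m : nat) : {poly rat} :=
  \sum_(s : 'S_n.+1 | #|porbits s| == m)
    \prod_(C in porbits s) geom (\sum_(i in C) c i).

(** The outer variable y counts cycles and the inner variable z records weights. Each cycle
    contributes y (1 - z^c(C)), and each 1 - z^c(C) splits off one factor 1 - z. *)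
Lemma coef_cycle_sum (m : nat) :
  (cycle_sum (fun v : {poly {poly rat}} => 'X * (1 - v)) [set: 'I_n.+1]
     (fun i => ('X^(c i))%:P))`_m = (1 - 'X) ^+ m * cycle_poly m.
Proof.
rewrite /cycle_sum /cycle_poly coef_sum mulr_sumr [RHS]big_mkcond /=.
apply: eq_big => s; first by apply/subsetP => x _; rewrite inE.
move=> _; rewrite (eq_bigl (mem (porbits s))) => [|C]; last first.
  by rewrite subsetT andbT.
rewrite big_split prodr_const /=.
rewrite (eq_bigr (fun C : {set 'I_n.+1} => (1 - 'X^(\sum_(i in C) c i))%:P)).
  rewrite -rmorph_prod mulrC coefCM coefXn eq_sym; case: eqP => [<-|_]; last first.
    by rewrite mulr0.
  rewrite mulr1 -prodr_const -big_split /=.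
  by apply: eq_bigr => C _; rewrite geomE.
by move=> C _; rewrite -rmorph_prod prodrXr rmorphB.
Qed.

Lemma oneBXn_cycle_poly (m : nat) :
  (1 - 'X) ^+ m.+1 * cycle_poly m.+1 =
  \sum_(S : {set 'I_n.+1})
    ((-1) ^+ #|S| * (shifted_rising 'X n #|S|)`_m) *: 'X^(\sum_(i in S) c i).
Proof.
rewrite -coef_cycle_sum (@cycle_sum_subsets _ _ _ n) ?cardsT ?card_ord //.
rewrite coef_sum; apply: eq_big => S; first by rewrite subsetT.
(* This factor does not involve z, so its coefficients in y are rational scalars; the extra factor y
   lowers the index from m + 1 to m. *)
move=> _; have -> : shifted_rising 'X n #|S|
    = map_poly polyC (shifted_rising 'X n #|S|) :> {poly {poly rat}}.
  by rewrite rmorph_shifted_rising /= map_polyX.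
rewrite -rmorph_prod prodrXr -(rmorphN1 polyC) -rmorphXn -rmorphM coefCM.
rewrite coefXM /= coef_map /= -(rmorphN1 polyC) -rmorphXn /= mulrAC -rmorphM.
by rewrite mul_polyC.
Qed.

End CoefficientIdentity.

(** * Eulerian polynomials and their product with the cycle polynomials *)

Definition eulerian_poly (m : nat) : {poly rat} :=
  \sum_(s : 'S_m) 'X^#|descents s|.

Lemma coef_eulerian_poly m j : (eulerian_poly m)`_j = (eulerian m j)%:R.
Proof.
rewrite coef_sum /eulerian -sum1_card natr_sum [RHS]big_mkcond /=.
by apply: eq_bigr => s _; rewrite coefXn inE eq_sym; case: eqP.
Qed.

(** There is no leading factor z here, so z^j carries the m-th power of j + 1. *)
Lemma worpitzky_poly (K m j : nat) : (j < K)%N ->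
  (eulerian_poly m * geom K ^+ m.+1)`_j = (j.+1 ^ m)%N%:R.
Proof.
move=> jK; rewrite mulr_suml coef_sum -worpitzky_perm natr_sum.
apply: eq_bigr => s _; rewrite coefXnM; case: ltnP => [ltjd|ledj].
  by rewrite bin_small //; have := card_descents_le s; lia.
by rewrite coef_geomX ?addnBAC // (leq_ltn_trans (leq_subr _ _)).
Qed.

(** Modulo z^(k+1) the factors (1 - z)^(m+1) and [geom k.+1 ^+ m.+1] cancel, so both may be
    inserted: the first turns the cycle polynomial into a signed sum over subsets, the second turns
    the Eulerian polynomial into m-th powers. *)
Lemma cycle_eulerian_coef (n : nat) (c : 'I_n.+1 -> nat) (m k : nat) :
  (cycle_poly c m.+1 * eulerian_poly m)`_k =
  \sum_(S : {set 'I_n.+1} | (\sum_(i in S) c i <= k)%N)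
    (-1) ^+ #|S| * (shifted_rising 'X n #|S|)`_m
    * ((k - \sum_(i in S) c i).+1 ^ m)%N%:R.
Proof.
have /(_ k (ltnSn k)) -> : eqmodXn k.+1 (cycle_poly c m.+1 * eulerian_poly m)
    ((1 - 'X) ^+ m.+1 * cycle_poly c m.+1 * (eulerian_poly m * geom k.+1 ^+ m.+1)).
  rewrite [X in eqmodXn _ _ X](_ : _ =
    cycle_poly c m.+1 * eulerian_poly m * (1 - 'X^(k.+1)) ^+ m.+1); last first.
    by rewrite -geomE exprMn; ring.
  rewrite -[X in eqmodXn _ X]mulr1; apply: eqmodXnM => //.
  have := eqmodXnX m.+1 (@oneBXn_eqmod rat k.+1); rewrite expr1n.
  exact: eqmodXn_sym.
rewrite oneBXn_cycle_poly mulr_suml coef_sum [RHS]big_mkcond; apply: eq_bigr => S _.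
rewrite -scalerAl coefZ coefXnM ltnNge.
case: leqP => /= leSk; last by rewrite mulr0.
by rewrite worpitzky_poly // ltnS leq_subr.
Qed.

(** * Coefficients as cardinalities *)

(** Expanding the product picks an exponent below [a i] for each [i]; the common bound [B] places
    these choices in a finite type. *)
Lemma coef_prod_geom_card (I : finType) (B : nat) (a : I -> nat) (N : nat) :
  (forall i, a i <= B)%N ->
  (\prod_i geom (a i) : {poly rat})`_N =
  #|[pred f : {ffun I -> 'I_B} |
      [forall i, f i < a i]%N && (\sum_i f i == N)%N]|%:R.
Proof.
move=> aB; rewrite (eq_bigr (fun i => \sum_(v < B | (v < a i)%N) 'X^v)); last first.
  by move=> i _; rewrite -big_ord_widen.
rewrite (bigA_distr_big_dep (fun i (v : 'I_B) => v < a i)%N (fun _ v => 'X^v)).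
rewrite coef_sum /=.
rewrite -sum1_card natr_sum [LHS]big_mkcond [RHS]big_mkcond; apply: eq_bigr => f _.
rewrite prodrXr coefXn [in RHS]inE eq_sym.
have -> : (f \in family (fun i (v : 'I_B) => v < a i)%N) = [forall i, f i < a i]%N.
  exact/familyP/forallP.
by case: [forall i, _]; case: eqP.
Qed.

From mathcomp Require Import finmap.
From mathcomp Require Import all_classical all_reals.

(** Weighted permutations and lattice points live in infinite types; this counts them through a
    parametrisation by a finite type. *)
Lemma fset_set_image_inj (T : finType) (U : choiceType) (P : pred T) (g : T -> U) :
  {in P &, injective g} ->
  finite_set (g @` [set x | P x])%classic /\
  #|` fset_set (g @` [set x | P x])%classic|%fset = #|P|.
Proof.
move=> g_inj; have finP : finite_set [set x | P x]%classic by [].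
split; first exact: finite_image.
rewrite fset_set_image // card_in_imfset /=; last first.
  by move=> x y; rewrite !in_fset_set // !inE => Px Py; apply: g_inj.
rewrite cardE; apply/perm_size/uniq_perm => [||x]; rewrite ?fset_uniq ?enum_uniq //.
by rewrite in_fset_set // mem_enum; apply/idP/idP; rewrite inE.
Qed.

Lemma W_coef (n l m : nat) (c : 'I_n.+1 -> nat) :
  (W l m c)%:R = (cycle_poly c m)`_l.
Proof.
pose B := (\sum_i c i)%N.
pose T := {s : 'S_n.+1 & {ffun cycle_of s -> 'I_B}}.
pose Q (s : 'S_n.+1) (f : {ffun cycle_of s -> 'I_B}) :=
  [forall C, f C < \sum_(i in val C) c i]%N && (\sum_C f C == l)%N.
pose P (x : T) := (#|porbits (tag x)| == m) && Q (tag x) (tagged x).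
pose g (x : T) : wperm n.+1 :=
  Tagged (fun s : 'S_n.+1 => {ffun cycle_of s -> nat})
         [ffun C => nat_of_ord (tagged x C)].
have leB (C : {set 'I_n.+1}) : (\sum_(i in C) c i <= B)%N.
  by rewrite /B [leqRHS](bigID (mem C)) /= leq_addr.
have g_inj : injective g.
  case=> s f [t h] e; have est : s = t := congr1 tag e.
  subst t; congr existT; apply/ffunP => C; apply: val_inj.
  (* Boolean equality of tagged pairs compares the dependent second components without a
     transport. *)
  have /eqP := e; rewrite -tag_eqE /tag_eq eqxx /= tagged_asE => /eqP/ffunP/(_ C).
  by rewrite !ffunE.
have imageE : compatible_wperms l m c = (g @` [set x | P x])%classic.
  apply/seteqP; split=> [[s w] [/= cw ms lw]|_ [[s f] Pf <-]].
    have ltB C : (w C < B)%N by apply: leq_trans (cw C) (leB _).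
    exists (Tagged (fun s : 'S_n.+1 => {ffun cycle_of s -> 'I_B})
             [ffun C => Ordinal (ltB C)]).
      rewrite /= /P /Q /= ms eqxx /=; apply/andP; split.
        by apply/forallP => C; rewrite ffunE; apply: cw.
      by rewrite -lw; apply/eqP/eq_bigr => C _; rewrite ffunE.
    by rewrite /g /=; congr existT; apply/ffunP => C; rewrite !ffunE.
  case/andP: Pf => /eqP ms /andP[fc /eqP fl]; split=> //=.
    by move=> C; rewrite ffunE; apply: (forallP fc).
  by rewrite /total_weight /= -fl; apply: eq_bigr => C _; rewrite ffunE.
rewrite /W imageE (fset_set_image_inj (in2W g_inj)).2.
rewrite -sum1_card.
rewrite -(sig_big_dep (fun s : 'S_n.+1 => #|porbits s| == m) Q (fun _ _ => 1%N)).
rewrite natr_sum /cycle_poly coef_sum; apply: eq_bigr => s _.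
by rewrite sum1_card (big_sub (porbits s)) (@coef_prod_geom_card _ B).
Qed.

(** * Lattice points of the dilated polytope *)

Lemma lattice_pointsE (R : realType) (n k t : nat) (c : 'I_n -> nat) (z : 'rV[int]_n) :
  (0 < t)%N ->
  lattice_points (dilate t (polytope_R R k c)) z <->
  (forall i, 0 <= z ord0 i <= (t * c i)%N%:Z) /\ \sum_i z ord0 i = (t * k)%N%:Z.
Proof.
move=> t0; have t0R : 0 < t%:R :> R by rewrite ltr0n.
have tN0 : t%:R != 0 :> R by rewrite gt_eqF.
split=> [[x [xc xk] xz]|[zc zk]].
  have zx i : (z ord0 i)%:~R = t%:R * x ord0 i :> R.
    by have /matrixP/(_ ord0 i) := xz; rewrite !mxE => ->.
  split=> [i|].
    have /andP[x0 xci] := xc i.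
    apply/andP; split; first by rewrite -(ler0z R) zx mulr_ge0.
    by rewrite -(ler_int R) zx -pmulrn natrM ler_pM2l.
  apply: (@intr_inj R); rewrite rmorph_sum /= (eq_bigr _ (fun i _ => zx i)).
  by rewrite -mulr_sumr xk -pmulrn natrM.
exists (t%:R^-1 *: map_mx intr z); last by rewrite scalerA divff // scale1r.
split=> [i|].
  have /andP[z0 zci] := zc i; rewrite !mxE mulr_ge0 ?invr_ge0 ?ler0z //=.
  by rewrite ler_pdivrMl // -natrM pmulrn ler_int.
under eq_bigr do rewrite !mxE.
by rewrite -mulr_sumr -rmorph_sum /= zk -pmulrn natrM mulKf.
Qed.

Lemma card_lattice_points (R : realType) (n k t : nat) (c : 'I_n -> nat) :
  (0 < t)%N ->
  finite_set (lattice_points (dilate t (polytope_R R k c))) /\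
  #|` fset_set (lattice_points (dilate t (polytope_R R k c)))|%fset%:R
  = (\prod_i geom (t * c i).+1 : {poly rat})`_(t * k).
Proof.
move=> t0; pose B := (\sum_i t * c i).+1%N.
have leB i : ((t * c i).+1 <= B)%N by rewrite ltnS (bigD1 i) //= leq_addr.
pose P := [pred f : {ffun 'I_n -> 'I_B} |
  [forall i, f i < (t * c i).+1]%N && (\sum_i f i == t * k)%N].
pose g (f : {ffun 'I_n -> 'I_B}) : 'rV[int]_n := \row_i (f i : nat)%:Z.
have g_inj : injective g.
  move=> f h /matrixP e; apply/ffunP => i; apply: val_inj.
  by have := e ord0 i; rewrite !mxE => -[].
have -> : lattice_points (dilate t (polytope_R R k c)) = (g @` [set x | P x])%classic.
  apply/seteqP; split=> [z|_ [f /andP[/forallP fc /eqP fk] <-]].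
    case/(lattice_pointsE _ _ _ _ t0) => zc zk.
    have ltB i : (`|z ord0 i| < B)%N.
      by have := leB i; have := zc i; lia.
    exists [ffun i => Ordinal (ltB i)].
      apply/andP; split.
        by apply/forallP => i; rewrite ffunE /=; have := zc i; lia.
      rewrite -eqz_nat -zk -natz natr_sum; apply/eqP/eq_bigr => i _.
      by rewrite ffunE /= natz gez0_abs //; case/andP: (zc i).
    apply/matrixP => i j; rewrite (ord1 i) !mxE ffunE /= gez0_abs //.
    by case/andP: (zc j).
  apply/(lattice_pointsE _ _ _ _ t0); split=> [i|].
    by rewrite mxE /= lez_nat -ltnS; apply: fc.
  rewrite -fk -natz natr_sum; apply: eq_bigr => i _.
  by rewrite mxE natz.
have [fin card] := fset_set_image_inj (in2W g_inj : {in P &, injective g}).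
by split=> //; rewrite card (@coef_prod_geom_card _ B).
Qed.

(** * The Ehrhart polynomial and its coefficients *)

(** Inclusion-exclusion at dilation t ranges over t c(S) + |S| <= t k. The range c(S) < k is
    independent of t, which makes the sum a polynomial in t. *)
Definition ehrhart_R (n k : nat) (c : 'I_n.+1 -> nat) : {poly rat} :=
  \sum_(S : {set 'I_n.+1} | (\sum_(i in S) c i < k)%N)
    ((-1) ^+ #|S| / n`!%:R) *:
    shifted_rising ((k - \sum_(i in S) c i)%N%:R *: 'X) n #|S|.

(* The polynomial [(D - s + 1) ... (D - s + n)] also counts correctly when
   [D < s <= n.+1], because one of its factors vanishes. *)
Lemma shifted_rising_bin (n D s : nat) : (0 < D)%N -> (s <= n.+1)%N ->
  shifted_rising D%:R n s =
  n`!%:R * (if (s <= D)%N then 'C(D - s + n, n) else 0)%N%:R :> rat.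
Proof.
move=> D0 sn; case: leqP => [sD|Ds]; last first.
  have ltn : (s - D.+1 < n)%N by lia.
  rewrite /shifted_rising (bigD1 (Ordinal ltn)) //= -natrD.
  by rewrite (_ : (D + _ = s)%N) ?subrr ?mul0r ?mulr0 //; lia.
rewrite -natrM mulnC bin_ffact ffact_prod natr_prod /shifted_rising.
rewrite [RHS](reindex_inj rev_ord_inj) /=; apply: eq_bigr => j _.
have := ltn_ord j => jn.
by rewrite -natrD -natrB; [congr (_%:R); lia | lia].
Qed.

Lemma ehrhart_R_is_ehrhart (R : realType) (n k : nat) (c : 'I_n.+1 -> nat) :
  (0 < k)%N -> is_ehrhart_poly (polytope_R R k c) (ehrhart_R k c).
Proof.
move=> k0 t t0; have [fin ->] := card_lattice_points R k c t0; split=> //.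
rewrite (@coef_prod_geom _ _ n) ?card_ord // /ehrhart_R horner_sum.
rewrite big_mkcond [RHS]big_mkcond; apply: eq_bigr => S _.
have -> : (\sum_(i in S) (t * c i).+1 = t * \sum_(i in S) c i + #|S|)%N.
  by rewrite -sum1_card big_distrr -big_split /=; apply: eq_bigr => i _; rewrite addn1.
have cS : (0 < \sum_(i in S) c i -> 0 < #|S|)%N.
  by rewrite card_gt0; apply: contraTneq => ->; rewrite big_set0.
have Sn : (#|S| <= n.+1)%N by rewrite -[X in (_ <= X)%N]card_ord max_card.
move: (\sum_(i in S) c i)%N cS => d cS; move: #|S| cS Sn => s cS Sn.
case: ltnP => [ltdk|lekd]; last first.
  (* Here c(S) >= k > 0, so [S] is nonempty and t c(S) + |S| > t k: this subset is absent from both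
     sums. *)
  by rewrite ifF //; apply/negbTE; rewrite -ltnNge; nia.
rewrite hornerZ -/(horner_eval t%:R _) rmorph_shifted_rising /= /horner_eval.
rewrite hornerZ hornerX -natrM shifted_rising_bin ?muln_gt0 ?subn_gt0 ?ltdk //.
have fN0 : n`!%:R != 0 :> rat by rewrite pnatr_eq0 -lt0n fact_gt0.
rewrite mulrA divfK // mulnBl ![(_ * t)%N]mulnC.
have -> : (s <= t * k - t * d)%N = (t * d + s <= t * k)%N.
  by apply/idP/idP; nia.
by case: ifP => _; rewrite ?mulr0 // subnDA.
Qed.

(** Replacing y by (k + 1 - c(S)) t multiplies the coefficient of y^m by the m-th power of k + 1 -
    c(S), the very power in [cycle_eulerian_coef]. The dilation parameter [k.+1] matches the
    coefficient of z^k there. *)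
Lemma coef_ehrhart_R (n k m : nat) (c : 'I_n.+1 -> nat) :
  (ehrhart_R k.+1 c)`_m = n`!%:R^-1 *
    (\sum_(0 <= l < k.+1) W l m.+1 c * eulerian m (k - l))%N%:R.
Proof.
have -> : (\sum_(0 <= l < k.+1) W l m.+1 c * eulerian m (k - l))%N%:R
    = (cycle_poly c m.+1 * eulerian_poly m)`_k.
  rewrite coefM natr_sum big_mkord; apply: eq_bigr => l _.
  by rewrite natrM W_coef coef_eulerian_poly.
rewrite cycle_eulerian_coef coef_sum mulr_sumr; apply: eq_bigr => S leSk.
rewrite coefZ -[X in shifted_rising X]comp_polyX -rmorph_shifted_rising.
rewrite coef_comp_scaleX subSn // natrX; ring.
Qed.

(** The difference vanishes at all positive integers, and the first [size (p - q)] of them already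
    exceed its possible number of roots if it is nonzero. *)
Lemma is_ehrhart_poly_unique (R : realType) (n : nat) (P : set 'rV[R]_n)
    (p q : {poly rat}) :
  is_ehrhart_poly P p -> is_ehrhart_poly P q -> p = q.
Proof.
move=> hp hq; apply/eqP; rewrite -subr_eq0; apply/eqP.
apply: (@roots_geq_poly_eq0 _ _ [seq t.+1%:R | t <- iota 0 (size (p - q))]).
- apply/allP => _ /mapP[t _ ->]; rewrite rootE hornerD hornerN.
  by rewrite (hp t.+1 isT).2 (hq t.+1 isT).2 subrr.
- rewrite map_inj_uniq ?iota_uniq // => i j /eqP.
  by rewrite eqr_nat => /eqP[].
- by rewrite size_map size_iota.
Qed.

Theorem theorem1p2 (R : realType) (n k : nat) (c : 'I_n -> nat)
    (c_gt0 : forall i, (0 < c i)%N)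
    (k_bounds : (0 < k < \sum_(i < n) c i)%N) :
  (exists p : {poly rat}, is_ehrhart_poly (polytope_R R k c) p) /\
  forall p : {poly rat}, is_ehrhart_poly (polytope_R R k c) p ->
    forall m : nat, (m <= n - 1)%N ->
      p`_m = (((n - 1)`!)%:R)^-1 *
             (\sum_(0 <= l < k) W l m.+1 c * eulerian m (k - l - 1))%N%:R.
Proof.
case/andP: k_bounds => k0.
case: n c c_gt0 => [|n] c c_gt0 => [|_]; first by rewrite big_ord0.
have ehr := ehrhart_R_is_ehrhart R c k0.
split=> [|p /is_ehrhart_poly_unique/(_ ehr) -> m _]; first by exists (ehrhart_R k c).
case: k k0 ehr => // k _ _; rewrite coef_ehrhart_R subn1.
congr (_ * _%:R); apply: eq_big_nat => l /andP[_ lk].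
by rewrite subSn // subn1.
Qed.
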